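(* Let $k\ge 1$ and let $N_{S_k}$ be the simply connected 2-step nilpotent Lie group attached to the star graph $S_k$ on $k+1$ vertices, endowed with its standard left-invariant metric. Let $r,r_1,\dots,r_k,m_1,\dots,m_k$ be nonzero integers, put $m_0=m_1m_2\cdots m_k$, and let $$\Lambda_{(r,m)}=r m_0\mathbb Z\times 2r_1\mathbb Z\times\cdots\times 2r_k\mathbb Z\times m_1\mathbb Z\times\cdots\times m_k\mathbb Z\subset N_{S_k}.$$ Let $\Lambda_{(r,m)}\backslash N_{S_k}$ be the corresponding compact manifold with the induced metric. Then the geodesic flow on $T(\Lambda_{(r,m)}\backslash N_{S_k})$ is completely integrable, with smooth first integrals $E$, $f_{Z_i}$, $\tilde F_i$ for $i=1,\dots,k$.
   Context: Group: $N_{S_k}$ is $\mathbb R^{2k+1}$ with coordinates $(x_0,x_1,\dots,x_k,z_1,\dots,z_k)$ and product $(x,z)(x',z')=(x_0+x_0',\dots,x_k+x_k',\ z_1+z_1'+\tfrac12(x_0x_1'-x_0'x_1),\dots,z_k+z_k'+\tfrac12(x_0x_k'-x_0'x_k))$. Its Lie algebra $\mathfrak n_{S_k}$ has the basis of left-invariant vector fields $V_0=\partial_{x_0}-\tfrac12\sum_{i}x_i\partial_{z_i}$, $V_i=\partial_{x_i}+\tfrac12x_0\partial_{z_i}$, $Z_i=\partial_{z_i}$ ($1\le i\le k$), with nonzero brackets $[V_0,V_i]=Z_i$. The standard metric $\langle\,,\rangle$ is the left-invariant metric making this basis orthonormal. One has $\exp(\sum x_iV_i+\sum z_jZ_j)=(x_0,\dots,x_k,z_1,\dots,z_k)$.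 Quotient: $\Lambda_{(r,m)}\backslash N_{S_k}$ carries the metric for which the projection from $N_{S_k}$ is a local isometry. Via left translations, $TN_{S_k}\simeq N_{S_k}\times\mathfrak n_{S_k}$, and $T(\Lambda_{(r,m)}\backslash N_{S_k})\simeq(\Lambda_{(r,m)}\backslash N_{S_k})\times\mathfrak n_{S_k}$. Functions: $E(\Lambda_{(r,m)}p,Y)=\tfrac12\langle Y,Y\rangle$ (energy); $f_{Z_i}(\Lambda_{(r,m)}p,Y)=\langle Z_i,Y\rangle$; and, with $p=\exp W$ and $f_{V_i^*}(p,Y)=\langle V_i-\langle W,V_0\rangle Z_i,\,Y\rangle$ on $TN_{S_k}$, $$\tilde F_i(\Lambda_{(r,m)}p,Y)=e^{-1/\langle Z_i,Y\rangle^2}\,\sin\!\Big(2\pi\,\frac{f_{V_i^*}(p,Y)}{\langle Z_i,Y\rangle}\Big),$$ extended by $0$ where $\langle Z_i,Y\rangle=0$. Integrability: for a Riemannian manifold $M$ of dimension $n$, $TM$ carries the symplectic form obtained from the canonical one on $T^*M$ via the metric, with Poisson bracket $\{\,,\}$. A smooth $f:TM\to\mathbb R$ is a first integral of the geodesic flow if $\{f,E\}=0$, where $E(v)=\tfrac12\langle v,v\rangle$. The geodesic flow is completely integrable (in the sense of Liouville) if there are $n$ first integrals $f_1,\dots,f_n:TM\to\mathbb R$ with $\{f_i,f_j\}=0$ for all $i,j$ and with gradients linearly independent on an open dense subset of $TM$. *)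

(* Defs.v *)
From HB Require Import structures.
From mathcomp Require Import all_boot all_order all_algebra.
From mathcomp Require Import generic_quotient.
From mathcomp Require Import all_classical all_reals all_analysis.
From mathcomp Require Import ring.

Set Implicit Arguments.
Unset Strict Implicit.
Unset Printing Implicit Defensive.
Import Order.TTheory GRing.Theory Num.Theory.
Import numFieldNormedType.Exports.

Local Open Scope classical_set_scope.
Local Open Scope ring_scope.

(* Only meant for a finite-dimensional V, where this is the usual notion. *)
Section Smooth.
Context {R : realType} {V : normedModType R}.

Fixpoint Cn (n : nat) (f : V -> R) : Prop :=
  if n is n'.+1 then
    (forall x, differentiable f x) /\ (forall v, Cn n' (fun x => 'D_v f x))
  else continuous f.

Definition smooth (f : V -> R) : Prop := forall n, Cn n f.

End Smooth.

(* Geodesic flows of Riemannian metrics on R^n, and of their quotients.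
   Tangent and cotangent vectors are row vectors; the pairing of a covector P
   with a vector v is P *m v^T. *)
Section GeodesicFlow.
Context {R : realType} {n : nat}.
Notation V := 'rV[R]_n.
Notation e := (fun a : 'I_n => delta_mx 0 a : V).

Definition inner (Y Y' : V) : R := (Y *m Y'^T) 0 0.

(* Poisson bracket of the canonical symplectic form on T^*R^n, in the
   coordinates (q, P). *)
Definition canonical_bracket (f g : V * V -> R) (w : V * V) : R :=
  \sum_(a < n) ('D_(e a, 0) f w * 'D_(0, e a) g w
              - 'D_(0, e a) f w * 'D_(e a, 0) g w).

(* The rows of [frame q] are the values at q of n vector fields that trivialize
   TR^n: the point (q, Y) of R^n x R^n stands for the tangent vector
   Y *m frame q at q.  [gram q] is the matrix, in the coordinates of R^n, of the
   metric that makes this frame orthonormal. *)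
Variable frame : V -> 'M[R]_n.

Definition gram (q : V) : 'M[R]_n := invmx (frame q) *m (invmx (frame q))^T.

(* The identification of TR^n with T^*R^n, v |-> <v, .>, read in the
   trivialization, and its inverse. *)
Definition flat (w : V * V) : V * V := (w.1, w.2 *m frame w.1 *m gram w.1).
Definition sharp (w : V * V) : V * V :=
  (w.1, w.2 *m invmx (gram w.1) *m invmx (frame w.1)).

Lemma flatK (w : V * V) : frame w.1 \in unitmx -> sharp (flat w) = w.
Proof.
case: w => q Y /= uF; rewrite /sharp /flat /= mulmxK ?mulmxK //.
by rewrite unitmx_mul unitmx_tr unitmx_inv uF.
Qed.

Lemma sharpK (w : V * V) : frame w.1 \in unitmx -> flat (sharp w) = w.
Proof.
case: w => q Y /= uF; rewrite /sharp /flat /= mulmxKV // mulmxKV //.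
by rewrite unitmx_mul unitmx_tr unitmx_inv uF.
Qed.

Definition poisson (f g : V * V -> R) (w : V * V) : R :=
  canonical_bracket (f \o sharp) (g \o sharp) (flat w).

(* The gradient for the metric on R^n x R^n that makes the fields
   (frame_a, 0) and (0, e_a) orthonormal, in the basis of these fields.  The
   linear independence of gradients does not depend on the metric. *)
Definition gradient (f : V * V -> R) (w : V * V) : 'rV[R]_(n + n) :=
  row_mx (\row_a 'D_(row a (frame w.1), 0) f w) (\row_a 'D_(0, e a) f w).

(* M is the quotient of R^n, with projection proj, by a group that acts properly
   discontinuously and freely and preserves the frame.  So TM is M x R^n,
   TR^n -> TM is a covering that is locally an isomorphism for all the
   structures above, and functions on TM are differentiated upstairs. *)
Context {M : topologicalType}.
Variable proj : V -> M.

Definition tproj (w : V * V) : M * V := (proj w.1, w.2).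

Definition smoothT (f : M * V -> R) : Prop := smooth (f \o tproj).

Definition poisson_commute (f g : M * V -> R) : Prop :=
  forall w, poisson (f \o tproj) (g \o tproj) w = 0.

Definition energy (v : M * V) : R := 2^-1 * inner v.2 v.2.

Definition first_integral (f : M * V -> R) : Prop :=
  smoothT f /\ poisson_commute f energy.

Definition independent_at (f : 'I_n -> M * V -> R) (w : V * V) : Prop :=
  row_free (\matrix_(j < n) gradient (f j \o tproj) w).

Definition liouville_system (f : 'I_n -> M * V -> R) : Prop :=
  [/\ forall j, first_integral (f j),
      forall i j, poisson_commute (f i) (f j) &
      exists U : set (M * V),
        [/\ open U, dense U & forall w, U (tproj w) -> independent_at f w]].

Definition completely_integrable : Prop :=
  exists f : 'I_n -> M * V -> R, liouville_system f.

End GeodesicFlow.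

(* The group N_{S_k}, in the coordinates (x_0, x_1..x_k, z_1..z_k).  Elements of
   its Lie algebra are given by their coordinates in V_0, V_1..V_k, Z_1..Z_k. *)
Section StarGroup.
Context {R : realType} {k : nat}.
Notation N := 'rV[R]_(1 + k + k).

Definition mkN (x0 : R) (x z : 'rV[R]_k) : N := row_mx (row_mx x0%:M x) z.
Definition cx0 (p : N) : R := lsubmx (lsubmx p) 0 0.
Definition cx (p : N) : 'rV[R]_k := rsubmx (lsubmx p).
Definition cz (p : N) : 'rV[R]_k := rsubmx p.

Lemma mkN_x0 x0 x z : cx0 (mkN x0 x z) = x0.
Proof. by rewrite /cx0 /mkN !row_mxKl mxE eqxx. Qed.

Lemma mkN_x x0 x z : cx (mkN x0 x z) = x.
Proof. by rewrite /cx /mkN row_mxKl row_mxKr. Qed.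

Lemma mkN_z x0 x z : cz (mkN x0 x z) = z.
Proof. by rewrite /cz /mkN row_mxKr. Qed.

Definition mkNE := (mkN_x0, mkN_x, mkN_z).

Lemma mkN_eta p : mkN (cx0 p) (cx p) (cz p) = p.
Proof. by rewrite /mkN /cx0 -mx11_scalar !hsubmxK. Qed.

Definition starM (p q : N) : N :=
  mkN (cx0 p + cx0 q) (cx p + cx q)
      (cz p + cz q + 2^-1 *: (cx0 p *: cx q - cx0 q *: cx p)).

Definition star1 : N := mkN 0 0 0.

Definition starV (p : N) : N := mkN (- cx0 p) (- cx p) (- cz p).

Lemma starMA : associative starM.
Proof.
move=> p q s; rewrite /starM !mkNE; congr mkN; rewrite ?addrA //.
by apply/rowP => i; rewrite !mxE; ring.
Qed.

Lemma star1M : left_id star1 starM.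
Proof.
move=> p; rewrite /starM /star1 !mkNE -[RHS]mkN_eta; congr mkN.
- by rewrite add0r.
- by rewrite add0r.
- by apply/rowP => i; rewrite !mxE; ring.
Qed.

Lemma starVM : left_inverse star1 starV starM.
Proof.
move=> p; rewrite /starM /starV /star1 !mkNE; congr mkN.
- by rewrite addNr.
- by rewrite addNr.
- by apply/rowP => i; rewrite !mxE; ring.
Qed.

Definition bV0 : N := mkN 1 0 0.
Definition bV (i : 'I_k) : N := mkN 0 (delta_mx 0 i) 0.
Definition bZ (i : 'I_k) : N := mkN 0 0 (delta_mx 0 i).

(* The vector fields V_0, V_i, Z_i; [fieldV0E], [fieldVE] and [fieldZE] state that
   they are left-invariant. *)
Definition fieldV0 (p : N) : N := mkN 1 0 (- (2^-1 *: cx p)).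
Definition fieldV (i : 'I_k) (p : N) : N :=
  mkN 0 (delta_mx 0 i) ((2^-1 * cx0 p) *: delta_mx 0 i).
Definition fieldZ (i : 'I_k) (p : N) : N := mkN 0 0 (delta_mx 0 i).

Definition star_frame (p : N) : 'M[R]_(1 + k + k) :=
  col_mx (col_mx (fieldV0 p) (\matrix_(i < k) fieldV i p))
         (\matrix_(i < k) fieldZ i p).

(* The differential of a left translation, which is an affine map. *)
Definition starD (p v : N) : N :=
  mkN (cx0 v) (cx v) (cz v + 2^-1 *: (cx0 p *: cx v - cx0 v *: cx p)).

Lemma cx0D p q : cx0 (p + q) = cx0 p + cx0 q.
Proof. by rewrite /cx0 !mxE. Qed.

Lemma cxD p q : cx (p + q) = cx p + cx q.
Proof. by apply/rowP => i; rewrite /cx !mxE. Qed.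

Lemma czD p q : cz (p + q) = cz p + cz q.
Proof. by apply/rowP => i; rewrite /cz !mxE. Qed.

Lemma mkND x0 x z y0 y t :
  mkN x0 x z + mkN y0 y t = mkN (x0 + y0) (x + y) (z + t).
Proof. by rewrite /mkN !add_row_mx raddfD. Qed.

Lemma starM_affine p q v : starM p (q + v) = starM p q + starD p v.
Proof.
rewrite /starM /starD mkND cx0D cxD czD !addrA; congr mkN.
by apply/rowP => i; rewrite !mxE; ring.
Qed.

Lemma fieldV0E p : fieldV0 p = starD p bV0.
Proof.
rewrite /starD /bV0 !mkNE; congr mkN.
by rewrite scaler0 add0r sub0r scale1r scalerN.
Qed.

Lemma fieldVE i p : fieldV i p = starD p (bV i).
Proof.
by rewrite /starD /bV !mkNE; congr mkN; rewrite add0r scale0r subr0 scalerA.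
Qed.

Lemma fieldZE i p : fieldZ i p = starD p (bZ i).
Proof.
by rewrite /starD /bZ !mkNE; congr mkN; rewrite scaler0 scale0r subrr scaler0 addr0.
Qed.


Lemma mul_star_frame (Y p : N) : Y *m star_frame p = starD p Y.
Proof.
have EV : \matrix_(i < k) fieldV i p =
    row_mx (row_mx 0 1%:M) (2^-1 * cx0 p)%:M :> 'M[R]_(k, 1 + k + k).
  apply/row_matrixP => i; rewrite rowK !row_row_mx row0 row1.
  by rewrite /fieldV /mkN raddf0 -scalemx1 linearZ /= row1.
have EZ : \matrix_(i < k) fieldZ i p =
    row_mx (row_mx 0 0) 1%:M :> 'M[R]_(k, 1 + k + k).
  apply/row_matrixP => i; rewrite rowK !row_row_mx !row0 row1.
  by rewrite /fieldZ /mkN raddf0.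
rewrite -[in LHS](mkN_eta Y) /star_frame EV EZ /fieldV0 /mkN.
rewrite !mul_row_col !mul_scalar_mx !scale_row_mx !mul_mx_row !mulmx0 !mulmx1.
rewrite !add_row_mx /starD /mkN mul_mx_scalar scale_scalar_mx mulr1 scaler0.
rewrite !addr0 add0r; congr row_mx.
by apply/rowP => i; rewrite !mxE; ring.
Qed.

Lemma star_frame_unit p : star_frame p \in unitmx.
Proof.
rewrite -row_free_unit -kermx_eq0; apply/rowV0P => Y /sub_kermxP.
rewrite mul_star_frame => Y0; rewrite -(mkN_eta Y).
have := congr1 cx0 Y0; have := congr1 cx Y0; have := congr1 cz Y0.
rewrite /starD !mkNE => z0 x0 c0; move: z0; rewrite x0 c0.
have -> : cx0 (0 : N) = 0 by rewrite /cx0 !mxE.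
have -> : cx (0 : N) = 0 by apply/rowP => i; rewrite /cx !mxE.
have -> : cz (0 : N) = 0 by apply/rowP => i; rewrite /cz !mxE.
rewrite scaler0 scale0r subrr scaler0 addr0 => ->.
by rewrite /mkN raddf0 !row_mx0.
Qed.

(* In these coordinates exp is the identity: by [star_exp_flow] the curve
   t |-> t W, whose velocity is W, is an integral curve of the left-invariant
   vector field of W. *)
Definition star_exp (W : N) : N := W.
Definition star_log (p : N) : N := p.

Lemma star_exp_flow (W : N) (t : R) : W *m star_frame (star_exp (t *: W)) = W.
Proof.
rewrite mul_star_frame /starD /star_exp -[RHS]mkN_eta; congr mkN.
by apply/rowP => i; rewrite /cx0 /cx !mxE; ring.
Qed.

End StarGroup.

(* The lattice Lambda_(r,m) and the quotient by its action by left translations,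
   whose points are the right cosets Lambda p. *)
Section Lattice.
Context {R : realType} {k : nat}.
Variables (r0 : int) (r m : 'I_k -> int).
Notation N := 'rV[R]_(1 + k + k).

Definition lattice : set N := [set p |
  [/\ exists a : int, cx0 p = (r0 * (\prod_(i < k) m i) * a)%:~R,
      forall i, exists b : int, cx p 0 i = (2 * r i * b)%:~R &
      forall i, exists c : int, cz p 0 i = (m i * c)%:~R]].

Lemma lattice1 : lattice star1.
Proof.
split; rewrite /star1 ?mkNE; first by exists 0; rewrite mulr0.
- by move=> i; exists 0; rewrite mulr0 mxE.
- by move=> i; exists 0; rewrite mulr0 mxE.
Qed.

Lemma latticeV p : lattice p -> lattice (starV p).
Proof.
move=> [[a pa] pb pc]; split; rewrite /starV ?mkNE.
- by exists (- a); rewrite pa mulrN rmorphN.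
- by move=> i; have [b E] := pb i; exists (- b); rewrite mxE E mulrN rmorphN.
- by move=> i; have [c E] := pc i; exists (- c); rewrite mxE E mulrN rmorphN.
Qed.

Lemma latticeM p q : lattice p -> lattice q -> lattice (starM p q).
Proof.
move=> [[a pa] pb pc] [[a' qa] qb qc]; split; rewrite /starM ?mkNE.
- by exists (a + a'); rewrite pa qa mulrDr rmorphD.
- move=> i; have [b E] := pb i; have [b' E'] := qb i.
  by exists (b + b'); rewrite mxE E E' mulrDr rmorphD.
- move=> i; have [b E] := pb i; have [b' E'] := qb i.
  have [c F] := pc i; have [c' F'] := qc i.
  exists (c + c' + r0 * (\prod_(j < k | j != i) m j) * r i * (a * b' - a' * b)).
  have RE (u v x y : 'rV[R]_k) s t : (u + v + 2^-1 *: (s *: x - t *: y)) 0 i =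
    u 0 i + v 0 i + 2^-1 * (s * x 0 i - t * y 0 i) by rewrite !mxE.
  rewrite RE E E' F F' pa qa (bigD1 i) //=.
  rewrite !(rmorphD, rmorphM, rmorphB, rmorphN) /=.
  have h : (2^-1 : R) * 2%:~R = 1 by rewrite mulVf.
  set P := _%:~R; set Q := (2%:~R : R) in h *.
  by field.
Qed.

Definition same_coset (p q : N) : bool :=
  `[< exists2 l, lattice l & q = starM l p >].

Lemma same_coset_refl : reflexive same_coset.
Proof. by move=> p; apply/asboolP; exists star1; rewrite ?star1M //; exact: lattice1. Qed.

Lemma same_coset_sym : symmetric same_coset.
Proof.
have H p q : same_coset p q -> same_coset q p.
  move=> /asboolP[l Ll ->]; apply/asboolP; exists (starV l); first exact: latticeV.
  by rewrite starMA starVM star1M.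
by move=> p q; apply/idP/idP; apply: H.
Qed.

Lemma same_coset_trans : transitive same_coset.
Proof.
move=> q p s /asboolP[l Ll ->] /asboolP[l' Ll' ->]; apply/asboolP.
by exists (starM l' l); [exact: latticeM | rewrite starMA].
Qed.

Canonical same_coset_equiv :=
  EquivRel same_coset same_coset_refl same_coset_sym same_coset_trans.

Definition nilmanifold : Type := quotient_topology {eq_quot same_coset_equiv}%qT.

HB.instance Definition _ := Topological.on nilmanifold.
HB.instance Definition _ := Quotient.on nilmanifold.

Definition nilproj (p : N) : nilmanifold := (\pi_nilmanifold p)%qT.

Lemma nilprojE p q : nilproj p = nilproj q <-> exists2 l, lattice l & q = starM l p.
Proof.
have cosetP := @eqmodP _ same_coset_equiv p q.
by split=> [/cosetP/asboolP|/asboolP/cosetP].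
Qed.

Definition f_Z (i : 'I_k) (v : nilmanifold * N) : R := inner (bZ i) v.2.

(* With p = exp W, f_Vstar i (p, Y) = <V_i - <W, V_0> Z_i, Y>. *)
Definition f_Vstar (i : 'I_k) (w : N * N) : R :=
  inner (bV i - inner (star_log w.1) bV0 *: bZ i) w.2.

Definition Ftilde_lift (i : 'I_k) (w : N * N) : R :=
  let z := inner (bZ i) w.2 in
  if z == 0 then 0 else expR (- (1 / z ^+ 2)) * sin (2 * pi * (f_Vstar i w / z)).

(* Ftilde_lift is invariant under the lattice, so that the choice of the
   representative does not matter. *)
Definition Ftilde (i : 'I_k) (v : nilmanifold * N) : R :=
  Ftilde_lift i (repr v.1, v.2).

Definition star_integrals (j : 'I_(1 + k + k)) : nilmanifold * N -> R :=
  match fintype.split j with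
  | inl j' => match fintype.split j' with inl _ => energy | inr i => f_Z i end
  | inr i => Ftilde i
  end.

End Lattice.

(* Main.v *)
(* Lifted to N, the integrals F_i are functions of P_{z_i} and of
   Y_i / P_{z_i} - x_0 = P_i / P_{z_i} - x_0 / 2, where P is the canonical
   momentum; so F_i involves only x_0, P_i and P_{z_i}, which makes the brackets
   with E, f_{Z_j} and F_j a short computation.  The F_i belong to the span of
   e^{-1/z^2} z^{-m} y^j sin(2 pi (y/z - x) + c), extended by 0 to z = 0, a family
   whose directional derivatives stay in its span: hence they are smooth.  The
   gradients are independent wherever Y_0 and all the derivatives of F_i along
   V_i are nonzero, because the derivatives along the fibre then form a
   triangular system; this set is open, and dense since cos(2 pi (y/z - x)) can
   be made nonzero by moving y. *)
Require Import Defs.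
From HB Require Import structures.
From mathcomp Require Import all_boot all_order all_algebra.
From mathcomp Require Import generic_quotient.
From mathcomp Require Import all_classical all_reals all_analysis.
From mathcomp Require Import ring lra.
Import Order.TTheory GRing.Theory Num.Theory.
Import numFieldNormedType.Exports.
Local Open Scope classical_set_scope.
Local Open Scope ring_scope.

(** * Vanishing differentials from quadratic bounds *)

Section Differential.
Context {R : realType} {V : normedModType R}.
Implicit Types f : V -> R.

(** Meant for points where the chain rule breaks down because of a division by 0. At h = 0 the bound
    forces f x = 0, and a quadratic bound is o(h). *)
Lemma is_diff_quadratic_bound f (x : V) (K : R) :
  (\forall h \near (0 : V), `|f (h + x)| <= K * `|h| ^+ 2) -> is_diff x f 0.
Proof.
move=> fK.
have fx0 : f x = 0.
  have := nbhs_singleton fK; rewrite /= add0r normr0 expr0n mulr0.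
  by rewrite normr_le0 => /eqP.
have fo : f \o shift x = cst (f x) + (\0 : {linear V -> R}) +o_ (0 : V) id.
  apply/eqaddoP => eps eps0; near=> h.
  have -> : (f \o shift x - (cst (f x) + (\0 : {linear V -> R}))) h = f (h + x).
    by rewrite /= !fctE /= /shift /= fx0 add0r subr0.
  have K1 : 0 < `|K| + 1 by rewrite ltr_wpDl.
  apply: (@le_trans _ _ (K * `|h| ^+ 2)); first by near: h.
  rewrite expr2 mulrA ler_wpM2r //=.
  apply: (@le_trans _ _ ((`|K| + 1) * `|h|)).
    by rewrite ler_wpM2r // (le_trans (ler_norm K)) // lerDl.
  rewrite mulrC -ler_pdivlMr //; near: h.
  by apply: nbhs0_le; rewrite divr_gt0.
have d0 : 'd f x = (\0 : {linear V -> R}) :> (V -> R).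
  by apply: diff_unique fo => y; exact: cvg_cst.
apply: DiffDef => //.
apply/diff_locallyP; rewrite d0; split => // y; exact: cvg_cst.
Unshelve. all: by end_near. Qed.

End Differential.

(** * The flat functions e^{-1/z^2} z^{-m} *)

Section FlatFunction.
Context {R : realType}.
Implicit Types (z : R) (m : nat).

Definition flat_exp m z : R :=
  if z == 0 then 0 else expR (- (1 / z ^+ 2)) * z^-1 ^+ m.

Lemma flat_exp0 m : flat_exp m 0 = 0.
Proof. by rewrite /flat_exp eqxx. Qed.

(** This also holds at z = 0, where both sides are 0, so powers of z can be traded for shifts of the
    index without case analysis. *)
Lemma flat_expS m z : z * flat_exp m.+1 z = flat_exp m z.
Proof.
rewrite /flat_exp; case: eqVneq => [->|z0]; first by rewrite mul0r.
by rewrite (exprS z^-1) mulrCA (mulVKf z0).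
Qed.

(** With u = 1/z^2, one term of the exponential series gives e^u >= u^{m+1}/(m+1)!, and u^{m+1} =
    |z|^{-2(m+1)} >= |z|^{-m} because |z| <= 1. *)
Lemma flat_exp_bounded m : exists C, forall z, `|z| <= 1 -> `|flat_exp m z| <= C.
Proof.
exists (m.+1)`!%:R => z z1; rewrite /flat_exp.
case: eqVneq => [_|z0]; first by rewrite normr0.
have nz0 : 0 < `|z| by rewrite normr_gt0.
set u := 1 / z ^+ 2.
have uE : u = `|z|^-1 ^+ 2 by rewrite /u div1r exprVn real_normK // num_real.
have u0 : 0 <= u by rewrite uE exprn_ge0 // invr_ge0.
have F0 : 0 < (m.+1)`!%:R :> R by rewrite ltr0n fact_gt0.
rewrite normrM ger0_norm ?expR_ge0 // expRN normrX normfV.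
rewrite ler_pdivrMl ?expR_gt0 // -ler_pdivrMr //.
apply: le_trans (expR_ge1Dxn m u0); rewrite -[leLHS]add0r lerD //.
rewrite ler_wpM2r ?invr_ge0 ?ler0n // uE -exprM.
apply: ler_weXn2l; first by rewrite invf_ge1.
exact: leq_trans (leqnSn m) (leq_pmull _ _).
Qed.

Lemma is_derive_flat_exp m z : z != 0 ->
  is_derive z 1 (flat_exp m) (2 * flat_exp m.+3 z - m%:R * flat_exp m.+1 z).
Proof.
move=> z0.
pose v (t : R) := t^-1.
have dv : is_derive z 1 v (- z ^- 2).
  by apply: is_derive_eq; [exact: is_deriveV | rewrite /GRing.scale /= mulr1].
have gE : \near z, ((expR \o (- (v ^+ 2))) * v ^+ m) z = flat_exp m z.
  near=> t; have t0 : t != 0 by near: t; apply: (cvgr_neq0 z).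
  by rewrite /flat_exp (negPf t0) div1r -exprVn !fctE.
apply: near_eq_is_derive gE _.
apply: is_derive_eq.
rewrite /flat_exp (negPf z0) /GRing.scale /= /v.
rewrite !fctE div1r -!exprVn; move: (expR _) => e; move: z^-1 => w.
case: m => [|m] /=; first by ring.
by rewrite !(exprS _ m.+3, exprS _ m.+2, exprS _ m.+1, exprS _ m); ring.
Unshelve. all: by end_near. Qed.

End FlatFunction.

Lemma is_derive_is_diff {R : realType} (f : R -> R) (t d : R) :
  is_derive t 1 f d -> is_diff t f (fun h => h * d).
Proof.
move=> [df fd]; apply: DiffDef; first exact/derivable1_diffP.
by rewrite deriv1E // derive1E fd.
Qed.

(** * Closure properties of smooth functions *)

Section SmoothFunctions.
Context {R : realType} {V : normedModType R}.
Implicit Types f g : V -> R.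

Lemma CnD n f g : Cn n f -> Cn n g -> Cn n (f + g).
Proof.
elim: n f g => [|n IHn] f g /=; first by
  move=> cf cg x; apply: continuousD; [exact: cf | exact: cg].
move=> [df Cf] [dg Cg]; split=> [x|v]; first exact: differentiableD.
have -> : (fun x => 'D_v (f + g) x) = (fun x => 'D_v f x) + (fun x => 'D_v g x).
  by apply/funext => x; rewrite deriveD //; exact: diff_derivable.
exact: IHn.
Qed.

Lemma CnZ n (a : R) f : Cn n f -> Cn n (a *: f).
Proof.
elim: n f => [|n IHn] f /=; first by
  move=> cf x; apply: (@continuousZl_tmp _ _ _ f a x); exact: cf.
move=> [df Cf]; split=> [x|v]; first exact: differentiableZ.
have -> : (fun x => 'D_v (a *: f) x) = a *: (fun x => 'D_v f x).
  by apply/funext => x; rewrite deriveZ //; exact: diff_derivable.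
exact: IHn.
Qed.

Lemma smooth_cst (a : R) : smooth (cst a : V -> R).
Proof.
move=> n; elim: n a => [|n IHn] a /=; first by move=> x; exact: cvg_cst.
split=> [x|v]; first exact: differentiable_cst.
rewrite (_ : (fun x => _) = cst 0) //.
by apply/funext => x; rewrite derive_cst.
Qed.

(** Being one's own differential at every point encodes a continuous linear form without bundling
    it. *)
Lemma smooth_linear f : (forall w, is_diff w f f) -> smooth f.
Proof.
move=> df [|n]; first by move=> x; apply: differentiable_continuous; case: (df x).
split=> [x|v]; first by case: (df x).
rewrite (_ : (fun x => _) = cst (f v)); first exact: smooth_cst.
by apply/funext => x; have [d E] := df x; rewrite deriveE // E.
Qed.

End SmoothFunctions.

(** * A family of flat oscillating functions stable under differentiation *)

Section Wave.
Context {R : realType} {V : normedModType R} (x y z : V -> R).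
Context (dx : forall w, is_diff w x x) (dy : forall w, is_diff w y y)
  (dz : forall w, is_diff w z z).
Implicit Types (m j : nat) (c : R) (w : V).

(** Here [x], [y], [z] are continuous linear forms. The phase [c] keeps cosines inside the family,
    as shifts by pi/2. *)
Definition wave m j c w : R :=
  flat_exp m (z w) * y w ^+ j * sin (2 * pi * (y w / z w - x w) + c).

Lemma wave_eq0 m j c w : z w = 0 -> wave m j c w = 0.
Proof. by move=> zw; rewrite /wave zw flat_exp0 !mul0r. Qed.

Lemma wave_exp m j c w : z w * wave m.+1 j c w = wave m j c w.
Proof. by rewrite /wave !mulrA flat_expS. Qed.

(** The three summands come from the flat factor, the power of [y] and the sine. The coefficient
    [j%:R] makes the truncated [j.-1] harmless at j = 0. *)
Definition dwave m j c w (v : V) : R :=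
  (2 * wave m.+3 j c w - m%:R * wave m.+1 j c w) * z v
  + j%:R * wave m j.-1 c w * y v
  + 2 * pi * (wave m.+1 j (c + pi / 2) w * y v
              - wave m.+2 j.+1 (c + pi / 2) w * z v
              - wave m j (c + pi / 2) w * x v).

(** By linearity z (h + w) = z h, and the flat factor supplies (z h)^2 times a bounded function; the
    power of [y] and the sine stay bounded near w, so the quadratic bound applies. *)
Lemma is_diff_wave0 m j c w : z w = 0 -> is_diff w (wave m j c) 0.
Proof.
move=> zw.
have [[dzw zE] [dyw yE]] := (dz w, dy w).
have zD h : z (h + w) = z h.
  by have := linearD ('d z w) h w; rewrite zE zw addr0.
have [k k0 kz] := linear_lipschitz (diff_continuous dzw).
have [k' k'0 ky] := linear_lipschitz (diff_continuous dyw).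
rewrite zE in kz; rewrite yE in ky.
have [C HC] := @flat_exp_bounded R m.+2.
pose M := `|C| * (`|y w| + 1) ^+ j.
apply: (@is_diff_quadratic_bound _ _ _ _ (k ^+ 2 * M)).
near=> h.
have zh1 : `|z h| <= 1.
  apply: le_trans (kz h) _; rewrite mulrC -ler_pdivlMr //.
  by near: h; apply: nbhs0_le; rewrite divr_gt0.
have yh : `|y (h + w)| <= `|y w| + 1.
  have := linearD ('d y w) h w; rewrite yE => ->.
  rewrite addrC (le_trans (ler_normD _ _)) // lerD2l (le_trans (ky h)) //.
  by rewrite mulrC -ler_pdivlMr //; near: h; apply: nbhs0_le; rewrite divr_gt0.
(* Two index shifts extract the factor (z h)^2, leaving [flat_exp m.+2], which [C] bounds. *)
rewrite /wave zD -flat_expS -flat_expS.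
set s := sin _.
have -> : z h * (z h * flat_exp m.+2 (z h)) * y (h + w) ^+ j * s =
  (z h) ^+ 2 * (flat_exp m.+2 (z h) * y (h + w) ^+ j * s) by ring.
rewrite normrM normrX [leRHS]mulrAC ler_pM ?exprn_ge0 //.
  by rewrite -exprMn lerXn2r // nnegrE // mulr_ge0 // ltW.
rewrite normrM -[leRHS]mulr1 ler_pM //; last first.
  by rewrite ler_norml sin_geN1 sin_le1.
rewrite normrM normrX ler_pM ?exprn_ge0 //.
  by apply: le_trans (HC _ zh1) _; exact: ler_norm.
by rewrite lerXn2r // nnegrE addr_ge0.
Unshelve. all: by end_near. Qed.

Lemma is_diff_wave m j c w : is_diff w (wave m j c) (dwave m j c w).
Proof.
have [zw|zw] := eqVneq (z w) 0.
  have -> : dwave m j c w = 0.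
    by apply/funext => v; rewrite /dwave !(wave_eq0 _ _ _ _ zw) -[RHS]/(0 : R); ring.
  exact: is_diff_wave0.
have dflat :=
  is_diff_comp (dz w) (is_derive_is_diff _ _ _ (is_derive_flat_exp m _ zw)).
have dinv : is_diff w (fun u => (z u)^-1) (fun v => - z v / z w ^+ 2).
  split; first exact: differentiableV (@ex_diff _ _ _ _ _ _ _ (dz w)) zw.
  rewrite (diffV (@ex_diff _ _ _ _ _ _ _ (dz w)) zw) diff_val.
  by apply/funext => v /=; rewrite !scaleNr mulNr mulrC.
have darg : is_diff w (fun u => 2 * pi * (y u / z u - x u) + c)
   (fun v => 2 * pi * (y v / z w - y w * z v / z w ^+ 2 - x v)).
  have -> : (fun u => 2 * pi * (y u / z u - x u) + c) =
      (2 * pi) *: (y * (fun u => (z u)^-1) - x) + cst c by [].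
  have d1 := is_diffM (dy w) dinv.
  have d2 := is_diffB d1 (dx w).
  have d3 := is_diffZ (2 * pi) d2.
  have d4 := is_diffD d3 (is_diff_cst c w).
  apply: is_diff_eq d4 _.
  apply/funext => v; rewrite !fctE /GRing.scale /= addr0; field.
  by rewrite zw.
have dsin := is_diff_comp darg (is_derive_is_diff _ _ _ (is_derive_sin _)).
have dyj : is_diff w (y ^+ j) (fun v => j%:R * y w ^+ j.-1 * y v).
  case: j => [|i]; last exact: is_diffX.
  have d1 := is_diff_cst (1 : R) w.
  rewrite expr0; apply: is_diff_eq d1 _.
  by apply/funext => v; rewrite !mul0r.
have waveE : wave m j c = (flat_exp m \o z) * (y ^+ j) *
    (sin \o (fun u => 2 * pi * (y u / z u - x u) + c)).
  by apply/funext => u; rewrite /wave !fctE.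
rewrite waveE; have d1 := is_diffM dflat dyj.
have d2 := is_diffM d1 dsin; apply: is_diff_eq d2 _.
apply/funext => v; rewrite !fctE /GRing.scale /= /dwave /wave.
(* All flat factors are brought to the common index m + 3, so that the claim becomes an identity of
   rational functions. *)
rewrite !addrA !sinDpihalf -!(flat_expS m) -!(flat_expS m.+1) -!(flat_expS m.+2).
rewrite (exprS (y w)); move: (flat_exp _ _) (sin _) (cos _) => F S C.
move: (y w) (z w) zw (y w ^+ j) (y w ^+ j.-1) (x v) (y v) (z v).
by move=> yw zw zw0 yj yj1 xv yv zv; field.
Qed.

Lemma dwaveE m j c w v : 'D_v (wave m j c) w = dwave m j c w v.
Proof. by have [df dE] := is_diff_wave m j c w; rewrite deriveE // dE. Qed.

Lemma smooth_wave m j c : smooth (wave m j c).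
Proof.
move=> n; elim: n m j c => [|n IHn] m j c.
  by move=> w; apply: differentiable_continuous; case: (is_diff_wave m j c w).
split=> [w|v]; first by case: (is_diff_wave m j c w).
(* For fixed v the numbers x v, y v, z v are constants, so the derivative is a linear combination of
   six waves and the induction hypothesis, general in the indices, applies to each. *)
have -> : (fun w => 'D_v (wave m j c) w) =
    (2 * z v) *: wave m.+3 j c + (- m%:R * z v) *: wave m.+1 j c
    + (j%:R * y v) *: wave m j.-1 c
    + (2 * pi * y v) *: wave m.+1 j (c + pi / 2)
    + (- 2 * pi * z v) *: wave m.+2 j.+1 (c + pi / 2)
    + (- 2 * pi * x v) *: wave m j (c + pi / 2).
  apply/funext => w; rewrite dwaveE /dwave !fctE /GRing.scale /=; ring.
by do !apply: CnD; apply: CnZ.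
Qed.

End Wave.

Lemma is_diff_linear {R : realType} {V : normedModType R} (f : V -> R) :
  linear f -> continuous f -> forall w, is_diff w f f.
Proof.
move=> lf cf w.
pose L : {linear V -> R} := HB.pack f (GRing.isLinear.Build _ _ _ _ f lf).
by split; [exact: (@linear_differentiable _ _ _ L) | exact: (@diff_lin _ _ _ L)].
Qed.

(** Reads a directional derivative off an expansion along one line: the difference quotient is a + t
    b for t nonzero. *)
Lemma derive_quadratic {R : realType} {V : normedModType R} (f : V -> R)
    (w v : V) (a b : R) :
  (forall t : R, f (w + t *: v) = f w + t * a + t ^+ 2 * b) -> 'D_v f w = a.
Proof.
move=> fE; rewrite /derive.
apply: cvg_lim => //.
have : (fun t : R => a + t * b) @ (0 : R)^' --> a + 0 * b.
  apply: cvg_within_filter.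
  by apply: cvgD; [exact: cvg_cst | apply: cvgM; [exact: cvg_id | exact: cvg_cst]].
rewrite mul0r addr0; apply: cvg_trans.
apply: near_eq_cvg; near=> t.
have t0 : t != 0 by near: t; exact: nbhs_dnbhs_neq.
by rewrite /= [_ *: v + w]addrC fE /GRing.scale /=; field.
Unshelve. all: by end_near. Qed.

(** * Inner products, coordinate forms and smoothness of the energy *)

Section Coordinates.
Context {R : realType} {n : nat}.
Notation V := 'rV[R]_n.

Lemma innerC (Y Y' : V) : inner Y Y' = inner Y' Y.
Proof. by rewrite /inner !mxE; apply: eq_bigr => a _; rewrite !mxE mulrC. Qed.

Lemma inner_delta (a : 'I_n) (Y : V) : inner (delta_mx 0 a) Y = Y 0 a.
Proof. by rewrite /inner -rowE !mxE. Qed.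

Lemma innerDl (X X' Y : V) : inner (X + X') Y = inner X Y + inner X' Y.
Proof. by rewrite /inner mulmxDl mxE. Qed.

Lemma innerZl (t : R) (X Y : V) : inner (t *: X) Y = t * inner X Y.
Proof. by rewrite /inner -scalemxAl mxE. Qed.

Lemma is_diff_coord_fst (t : R) (a : 'I_n) (w : V * V) :
  is_diff w (fun u => t * u.1 0 a) (fun u => t * u.1 0 a).
Proof.
apply: (is_diff_linear (fun u : V * V => t * u.1 0 a)) => [s u v|u] /=.
  by rewrite !mxE /GRing.scale /=; ring.
apply: cvgM; first exact: cvg_cst.
apply: (@continuous_comp _ _ _ fst (fun N : V => N 0 a)).
  exact: cvg_fst.
exact: coord_continuous.
Qed.

Lemma is_diff_coord_snd (a : 'I_n) (w : V * V) :
  is_diff w (fun u => u.2 0 a) (fun u => u.2 0 a).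
Proof.
apply: (is_diff_linear (fun u : V * V => u.2 0 a)) => [s u v|u] /=.
  by rewrite !mxE.
apply: (@continuous_comp _ _ _ snd (fun N : V => N 0 a)).
  exact: cvg_snd.
exact: coord_continuous.
Qed.

Lemma smooth_energy {M : topologicalType} (proj : V -> M) : smoothT proj energy.
Proof.
(* The derivative of l^2 along v is 2 l(v) l, a continuous linear form and hence smooth, so one
   differentiation suffices. *)
have sq (l : V * V -> R) m : (forall w, is_diff w l l) -> Cn m (l ^+ 2).
  move=> dl; case: m => [|m].
    move=> w; apply: differentiable_continuous; apply: differentiableX.
    by case: (dl w).
  split=> [w|v]; first by apply: differentiableX; case: (dl w).
  have -> : (fun w => 'D_v (l ^+ 2) w) = (2 * l v) *: l.
    apply/funext => w; have [d E] := dl w.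
    rewrite deriveX; last exact: diff_derivable.
    by rewrite deriveE // E !fctE /GRing.scale /= expr1; ring.
  by apply: CnZ; exact: smooth_linear.
move=> m.
have -> : energy \o tproj proj =
    2^-1 *: \sum_(a < n) ((fun w : V * V => w.2 0 a) ^+ 2).
  apply/funext => w; rewrite !fctE fct_sumE /energy /inner !mxE /=.
  by congr (_ * _); apply: eq_bigr => a _; rewrite !mxE exprfctE expr2.
apply: CnZ; elim/big_ind: _ => [|f g|a _].
- exact: smooth_cst.
- exact: CnD.
- by apply: sq; exact: is_diff_coord_snd.
Qed.

End Coordinates.

(** * From covectors to frame components; symmetries of the bracket *)

Section Sharp.
Context {R : realType} {n : nat}.
Variable frame : 'rV[R]_n -> 'M[R]_n.

(** In an orthonormal frame the components of the vector dual to a covector are the values of the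
    covector on the frame vectors. *)
Lemma sharpE (w : 'rV[R]_n * 'rV[R]_n) : frame w.1 \in unitmx ->
  sharp frame w = (w.1, w.2 *m (frame w.1)^T).
Proof.
case: w => q P /= uF.
have <- : flat frame (q, P *m (frame q)^T) = (q, P).
  rewrite /flat /gram /= !mulmxA mulmxK // -mulmxA -trmx_mul mulVmx //.
  by rewrite trmx1 mulmx1.
by rewrite flatK.
Qed.

Lemma canonical_bracketN (f g : 'rV[R]_n * 'rV[R]_n -> R) w :
  canonical_bracket f g w = - canonical_bracket g f w.
Proof. by rewrite /canonical_bracket -sumrN; apply: eq_bigr => a _; ring. Qed.

Lemma canonical_bracket_self (f : 'rV[R]_n * 'rV[R]_n -> R) w :
  canonical_bracket f f w = 0.
Proof. by rewrite /canonical_bracket big1 // => a _; ring. Qed.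

End Sharp.

(** * Coordinates and momenta on the star group *)

Section StarCoordinates.
Context {R : realType} {k : nat}.
Notation N := 'rV[R]_(1 + k + k).

Definition ix0 : 'I_(1 + k + k) := lshift k (lshift k ord0).
Definition ix (i : 'I_k) : 'I_(1 + k + k) := lshift k (rshift 1 i).
Definition iz (i : 'I_k) : 'I_(1 + k + k) := rshift (1 + k) i.

Variant star_index_spec : 'I_(1 + k + k) -> Type :=
| StarIndex0 : star_index_spec ix0
| StarIndexX i : star_index_spec (ix i)
| StarIndexZ i : star_index_spec (iz i).

Lemma star_indexP a : star_index_spec a.
Proof.
rewrite -(splitK a); case: (fintype.split a) => [b|i] /=; last exact: StarIndexZ.
rewrite -(splitK b); case: (fintype.split b) => [c|i] /=; last exact: StarIndexX.
by rewrite (ord1 c); exact: StarIndex0.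
Qed.

Lemma eq_ix0_ix i : (ix0 == ix i) = false.
Proof. by rewrite -val_eqE. Qed.
Lemma eq_ix0_iz i : (ix0 == iz i) = false.
Proof. by rewrite -val_eqE. Qed.
Lemma eq_ix_iz i j : (ix i == iz j) = false.
Proof. by rewrite -val_eqE /= ltn_eqF // ltn_add2l ltn_addr. Qed.
Lemma eq_ix i j : (ix i == ix j) = (i == j).
Proof. by rewrite -!val_eqE /= eqn_add2l. Qed.
Lemma eq_iz i j : (iz i == iz j) = (i == j).
Proof. by rewrite -!val_eqE /= eqn_add2l. Qed.
Lemma eq_ix_ix0 i : (ix i == ix0) = false.
Proof. by rewrite eq_sym eq_ix0_ix. Qed.
Lemma eq_iz_ix0 i : (iz i == ix0) = false.
Proof. by rewrite eq_sym eq_ix0_iz. Qed.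
Lemma eq_iz_ix i j : (iz i == ix j) = false.
Proof. by rewrite eq_sym eq_ix_iz. Qed.
Definition star_index_eqE := (eq_ix0_ix, eq_ix0_iz, eq_ix_iz, eq_ix, eq_iz,
  eq_ix_ix0, eq_iz_ix0, eq_iz_ix).

Lemma cx0E (p : N) : cx0 p = p 0 ix0.
Proof. by rewrite /cx0 !mxE. Qed.
Lemma cxE (p : N) i : cx p 0 i = p 0 (ix i).
Proof. by rewrite /cx !mxE. Qed.
Lemma czE (p : N) i : cz p 0 i = p 0 (iz i).
Proof. by rewrite /cz !mxE. Qed.

Lemma mkN_ix0 (a : R) x z : mkN a x z 0 ix0 = a.
Proof. by rewrite -cx0E mkN_x0. Qed.
Lemma mkN_ix (a : R) x z i : mkN a x z 0 (ix i) = x 0 i.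
Proof. by rewrite -cxE mkN_x. Qed.
Lemma mkN_iz (a : R) x z i : mkN a x z 0 (iz i) = z 0 i.
Proof. by rewrite -czE mkN_z. Qed.

Lemma bV0_delta : bV0 = delta_mx 0 ix0 :> N.
Proof.
apply/rowP => a; case: (star_indexP a) => [|i|i];
  by rewrite ?(mkN_ix0, mkN_ix, mkN_iz) !mxE eqxx ?star_index_eqE.
Qed.

Lemma bV_delta i : bV i = delta_mx 0 (ix i) :> N.
Proof.
apply/rowP => a; case: (star_indexP a) => [|j|j];
  by rewrite ?(mkN_ix0, mkN_ix, mkN_iz) !mxE eqxx ?star_index_eqE.
Qed.

Lemma bZ_delta i : bZ i = delta_mx 0 (iz i) :> N.
Proof.
apply/rowP => a; case: (star_indexP a) => [|j|j];
  by rewrite ?(mkN_ix0, mkN_ix, mkN_iz) !mxE eqxx ?star_index_eqE.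
Qed.

Lemma inner_mkN (a b : R) (x y z t : 'rV[R]_k) :
  inner (mkN a x z) (mkN b y t) = a * b + inner x y + inner z t.
Proof.
rewrite /inner /mkN !tr_row_mx !mul_row_col mxE; congr (_ + _).
by rewrite mxE tr_scalar_mx mul_scalar_mx !mxE eqxx.
Qed.

(** The values of the covector P on V_0, V_i, Z_i at q. *)
Definition star_momenta (q P : N) : N :=
  mkN (cx0 P - 2^-1 * inner (cx q) (cz P)) (cx P + (2^-1 * cx0 q) *: cz P) (cz P).

Lemma mul_star_frameT (q P : N) : P *m (star_frame q)^T = star_momenta q P.
Proof.
apply/rowP => a.
have -> : (P *m (star_frame q)^T) 0 a = inner (starD q (delta_mx 0 a)) P.
  by rewrite -mul_star_frame -rowE innerC /inner !mxE; apply: eq_bigr => b _;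
    rewrite !mxE.
rewrite -{1}(mkN_eta P).
case: (star_indexP a) => [|i|i].
- rewrite -bV0_delta -fieldV0E inner_mkN mkN_ix0 -scaleNr innerZl /inner mul0mx mxE.
  by ring.
- rewrite -bV_delta -fieldVE inner_mkN mkN_ix innerZl !inner_delta !mxE; ring.
- rewrite -bZ_delta -fieldZE inner_mkN mkN_iz !inner_delta /inner mul0mx mxE.
  by ring.
Qed.

Lemma sharp_star (w : N * N) :
  sharp star_frame w = (w.1, star_momenta w.1 w.2).
Proof. by rewrite sharpE ?star_frame_unit // mul_star_frameT. Qed.

End StarCoordinates.

Lemma sinD2pi_int {R : realType} (n : int) (t : R) :
  sin (t + 2 * pi * n%:~R) = sin t.
Proof.
have pos (j : nat) (s : R) : sin (s + 2 * pi * j%:R) = sin s.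
  rewrite -[RHS](periodicn (@sinD2pi R) j); congr (sin (_ + _)).
  by rewrite mulr_natr mulr_natl.
case: n => j; first exact: pos.
by rewrite NegzE rmorphN /= mulrN -(pos j.+1) subrK.
Qed.

(** * The integrals F_i as waves on the group and on the quotient *)

Section StarWave.
Context {R : realType} {k : nat}.
Notation N := 'rV[R]_(1 + k + k).

(** The weight [t] of x_0 in the phase is 1 in the left trivialization (q, Y), 1/2 in the canonical
    coordinates (q, P), and 0 when the dependence on x_0 has been split off. *)
Definition star_wave (t : R) (i : 'I_k) : nat -> nat -> R -> N * N -> R :=
  wave (fun w : N * N => t * w.1 0 ix0) (fun w => w.2 0 (ix i))
    (fun w => w.2 0 (iz i)).

Lemma smooth_star_wave t i m j c : smooth (star_wave t i m j c).
Proof.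
exact: (smooth_wave _ _ _ (is_diff_coord_fst t ix0) (is_diff_coord_snd (ix i))
  (is_diff_coord_snd (iz i))).
Qed.

Lemma derive_star_wave t i m j c w v : 'D_v (star_wave t i m j c) w =
  dwave (fun w : N * N => t * w.1 0 ix0) (fun w => w.2 0 (ix i))
    (fun w => w.2 0 (iz i)) m j c w v.
Proof.
exact: (dwaveE _ _ _ (is_diff_coord_fst t ix0) (is_diff_coord_snd (ix i))
  (is_diff_coord_snd (iz i))).
Qed.

Lemma Ftilde_liftE i : Ftilde_lift i = star_wave 1 i 0 0 0 :> (N * N -> R).
Proof.
apply/funext => w; rewrite /Ftilde_lift /star_wave /wave /flat_exp.
rewrite bZ_delta inner_delta; case: eqVneq => [|z0]; first by rewrite !mul0r.
rewrite !expr0 !mulr1 addr0; congr (_ * sin (_ * _)).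
rewrite /f_Vstar bV_delta bZ_delta bV0_delta /star_log -scaleNr.
by rewrite innerDl innerZl !inner_delta (innerC w.1) inner_delta; field.
Qed.

Section Quotient.
Variables (r0 : int) (r m : 'I_k -> int).

(** A lattice element adds an integer to x_0, hence an integer multiple of 2 pi to the argument of
    the sine. *)
Lemma star_wave_lattice i a j c (l p Y : N) : lattice r0 r m l ->
  star_wave 1 i a j c (starM l p, Y) = star_wave 1 i a j c (p, Y).
Proof.
move=> [[n ln] _ _]; rewrite /star_wave /wave /=; congr (_ * _).
rewrite -[RHS](sinD2pi_int (- (r0 * (\prod_(i < k) m i) * n))); congr sin.
by rewrite -!cx0E mkN_x0 ln rmorphN; ring.
Qed.

Lemma star_wave_repr i a j c (p Y : N) :
  star_wave 1 i a j c (repr (nilproj r0 r m p), Y) = star_wave 1 i a j c (p, Y).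
Proof.
have : nilproj r0 r m p = nilproj r0 r m (repr (nilproj r0 r m p)).
  by rewrite {2}/nilproj reprK.
by move=> /nilprojE[l Ll ->]; exact: star_wave_lattice.
Qed.

Lemma Ftilde_nilproj i (p Y : N) :
  Ftilde i (nilproj r0 r m p, Y) = Ftilde_lift i (p, Y).
Proof. by rewrite /Ftilde Ftilde_liftE star_wave_repr. Qed.

End Quotient.
End StarWave.

(** * Poisson brackets in canonical coordinates *)

Section Brackets.
Context {R : realType} {k : nat}.
Notation N := 'rV[R]_(1 + k + k).

Definition Z_momentum (i : 'I_k) (w : N * N) : R := w.2 0 (iz i).

Definition hamiltonian (w : N * N) : R :=
  2^-1 * inner (star_momenta w.1 w.2) (star_momenta w.1 w.2).

Lemma derive_Z_momentum i (w v : N * N) :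
  'D_v (Z_momentum i) w = v.2 0 (iz i).
Proof.
apply: (@derive_quadratic _ _ _ _ _ _ 0) => t.
by rewrite /Z_momentum !mxE mulr0 addr0.
Qed.

Lemma derive_Z_momentum_q i (w : N * N) a :
  'D_(delta_mx 0 a, 0) (Z_momentum i) w = 0.
Proof. by rewrite derive_Z_momentum mxE. Qed.

Lemma derive_Z_momentum_P i (w : N * N) a :
  'D_(0, delta_mx 0 a) (Z_momentum i) w = (a == iz i)%:R.
Proof. by rewrite derive_Z_momentum mxE eqxx eq_sym. Qed.

(** Covers the directions in which only Y_0 = P_0 - 1/2 sum_i x_i P_{z_i} varies, and linearly.
    These are P_0, x_i and z_i, the ones conjugate to the variables x_0, P_i, P_{z_i} of the other
    integrals. *)
Lemma derive_hamiltonian (w v : N * N) (s : R) :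
  (forall t, star_momenta (w + t *: v).1 (w + t *: v).2 =
             star_momenta w.1 w.2 + (t * s) *: delta_mx 0 ix0) ->
  'D_v hamiltonian w = s * star_momenta w.1 w.2 0 ix0.
Proof.
move=> wv; apply: (@derive_quadratic _ _ _ _ _ _ (2^-1 * s ^+ 2)) => t.
rewrite /hamiltonian wv; move: (star_momenta _ _) => M.
rewrite innerDl innerZl (innerC M) innerDl innerZl !inner_delta !mxE !eqxx /=.
by field.
Qed.

Lemma star_momenta_line (q P q' P' : N) (t s : R) :
  cz P' = 0 -> cx P' = 0 -> cx0 q' = 0 ->
  cx0 P' - 2^-1 * inner (cx q') (cz P) = s ->
  star_momenta (q + t *: q') (P + t *: P') =
  star_momenta q P + (t * s) *: delta_mx 0 ix0.
Proof.
move=> z0 x0 q0 <-.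
have cxZ (X : N) : cx (t *: X) = t *: cx X by apply/rowP => a; rewrite !mxE.
have czZ (X : N) : cz (t *: X) = t *: cz X by apply/rowP => a; rewrite !mxE.
have cx0Z (X : N) : cx0 (t *: X) = t * cx0 X by rewrite !cx0E mxE.
rewrite /star_momenta !cx0D !cxD !czD cx0Z (cx0Z q') !cxZ !czZ z0 x0 q0.
rewrite !(scaler0, mulr0, addr0) innerDl innerZl.
have RE (X Y : N) c a : (X + c *: Y) 0 a = X 0 a + c * Y 0 a by rewrite !mxE.
apply/rowP => a; rewrite RE; case: (star_indexP a) => [|i|i].
- by rewrite !mkN_ix0 mxE !eqxx /=; ring.
- by rewrite !mkN_ix [delta_mx _ _ _ _]mxE star_index_eqE andbF mulr0 addr0.
- by rewrite !mkN_iz [delta_mx _ _ _ _]mxE star_index_eqE andbF mulr0 addr0.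
Qed.

Lemma derive_hamiltonian_P0 (w : N * N) :
  'D_(0, delta_mx 0 ix0) hamiltonian w = star_momenta w.1 w.2 0 ix0.
Proof.
rewrite (@derive_hamiltonian _ _ 1) ?mul1r // => t.
apply: star_momenta_line; rewrite -?bV0_delta ?mkNE ?cx0E ?mxE //.
have -> : cx (0 : N) = 0 by apply/rowP => i; rewrite !mxE.
by rewrite /inner mul0mx mxE mulr0 subr0.
Qed.

Lemma derive_hamiltonian_x i (w : N * N) :
  'D_(delta_mx 0 (ix i), 0) hamiltonian w =
  - (2^-1 * w.2 0 (iz i)) * star_momenta w.1 w.2 0 ix0.
Proof.
apply: derive_hamiltonian => t.
apply: star_momenta_line;
  rewrite -?bV_delta ?mkNE ?inner_delta ?czE ?cx0E ?mxE ?sub0r //.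
  by apply/rowP => a; rewrite !mxE.
by apply/rowP => a; rewrite !mxE.
Qed.

Lemma derive_hamiltonian_z i (w : N * N) :
  'D_(delta_mx 0 (iz i), 0) hamiltonian w = 0.
Proof.
rewrite (@derive_hamiltonian _ _ 0) ?mul0r // => t.
apply: star_momenta_line; rewrite -?bZ_delta ?mkNE ?cx0E ?mxE //.
- by apply/rowP => a; rewrite !mxE.
- by apply/rowP => a; rewrite !mxE.
- by rewrite /inner mul0mx mxE mulr0 subr0.
Qed.

Lemma derive_star_wave_q t i (w : N * N) a :
  'D_(delta_mx 0 a, 0) (star_wave t i 0 0 0) w =
  - (2 * pi * t * star_wave t i 0 0 (pi / 2) w) * (a == ix0)%:R.
Proof.
rewrite derive_star_wave /dwave !mxE eqxx add0r eq_sym /=.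
rewrite -!/(star_wave t i _ _ _); ring.
Qed.

Lemma derive_star_wave_P t i (w : N * N) a :
  'D_(0, delta_mx 0 a) (star_wave t i 0 0 0) w =
  2 * pi * star_wave t i 1 0 (pi / 2) w * (a == ix i)%:R +
  (2 * star_wave t i 3 0 0 w - 2 * pi * star_wave t i 2 1 (pi / 2) w)
     * (a == iz i)%:R.
Proof.
rewrite derive_star_wave /dwave !mxE eqxx !add0r ![_ == a]eq_sym /=.
rewrite -!/(star_wave t i _ _ _); ring.
Qed.

Lemma bracket_Z_Z i j (w : N * N) :
  canonical_bracket (Z_momentum i) (Z_momentum j) w = 0.
Proof.
rewrite /canonical_bracket big1 // => a _.
by rewrite !derive_Z_momentum_q mulr0 mul0r subr0.
Qed.

Lemma bracket_wave_Z t i j (w : N * N) :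
  canonical_bracket (star_wave t i 0 0 0) (Z_momentum j) w = 0.
Proof.
rewrite /canonical_bracket big1 // => a _.
rewrite derive_star_wave_q derive_Z_momentum_P derive_Z_momentum_q mulr0 subr0.
by case: (star_indexP a) => [|l|l];
  rewrite ?star_index_eqE ?mulr0 ?mul0r.
Qed.

(** Position derivatives live along x_0 only and momentum derivatives along P_i and P_{z_i} only, so
    no conjugate pair meets. *)
Lemma bracket_wave_wave t i j (w : N * N) :
  canonical_bracket (star_wave t i 0 0 0) (star_wave t j 0 0 0) w = 0.
Proof.
rewrite /canonical_bracket big1 // => a _.
rewrite !derive_star_wave_q !derive_star_wave_P.
by case: (star_indexP a) => [|l|l];
  rewrite !star_index_eqE !(mulr0, mul0r, addr0, subrr).
Qed.

Lemma bracket_hamiltonian_Z i (w : N * N) :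
  canonical_bracket hamiltonian (Z_momentum i) w = 0.
Proof.
rewrite /canonical_bracket big1 // => a _.
rewrite [X in _ * X - _]derive_Z_momentum_P [X in _ - _ * X]derive_Z_momentum_q.
have : a = iz i -> 'D_(delta_mx 0 a, 0) hamiltonian w = 0.
  by move=> ->; exact: derive_hamiltonian_z.
move: ('D_(delta_mx 0 a, 0) _ _) ('D_(0, _) _ _) => x y x0.
by rewrite mulr0 subr0; case: eqVneq => [/x0->|_]; rewrite ?mul0r ?mulr0.
Qed.

(** The pair (x_0, P_0) contributes -pi W_0 Y_0 and the pair (x_i, P_i) contributes pi P_{z_i} W_1
    Y_0, with W_0, W_1 the waves of flat index 0 and 1 and phase pi/2. They cancel since W_0 =
    P_{z_i} W_1; the weight 1/2 of x_0 matches the 1/2 in Y_0. *)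
Lemma bracket_wave_hamiltonian i (w : N * N) :
  canonical_bracket (star_wave 2^-1 i 0 0 0) hamiltonian w = 0.
Proof.
rewrite /canonical_bracket (bigD1 ix0) //= (bigD1 (ix i)) //= big1 => [|a].
  rewrite derive_hamiltonian_P0 derive_hamiltonian_x !derive_star_wave_q.
  rewrite !derive_star_wave_P !star_index_eqE !eqxx.
  have <- : w.2 0 (iz i) * star_wave 2^-1 i 1 0 (pi / 2) w =
            star_wave 2^-1 i 0 0 (pi / 2) w by exact: wave_exp.
  move: (star_wave _ _ 1%N _ _ _) (star_wave _ _ 3%N _ _ _) => W1 W3.
  move: (star_wave _ _ _ _ _ _) (star_momenta _ _ _ _) (w.2 _ _) => W2 Y0 z.
  move: ('D_ _ _ _) ('D_ _ _ _) => d1 d2.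
  by rewrite /=; field.
move=> /andP[a0 ai].
rewrite derive_star_wave_q derive_star_wave_P (negPf a0) (negPf ai).
have : a = iz i -> 'D_(delta_mx 0 a, 0) hamiltonian w = 0.
  by move=> ->; exact: derive_hamiltonian_z.
move: ('D_(delta_mx 0 a, 0) _ _) ('D_(0, _) _ _) => x y x0.
by case: eqVneq => [/x0->|_];
  rewrite !(mulr0, mul0r, add0r, addr0, subr0, oppr0).
Qed.

End Brackets.

(** * Independence of the gradients on an open dense set *)

Lemma exists_near_neq0 {R : realType} (a e : R) : 0 < e ->
  exists b, `|a - b| < e /\ b != 0.
Proof.
move=> e0; have [->|a0] := eqVneq a 0.
  exists (e / 2); have e2 : 0 < e / 2 by rewrite divr_gt0.
  by rewrite sub0r normrN gtr0_norm // gt_eqF //; split=> //; lra.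
by exists a; rewrite subrr normr0.
Qed.

Lemma exists_near_cos_neq0 {R : realType} (x y z e : R) : z != 0 -> 0 < e ->
  exists y', `|y - y'| < e /\ cos (2 * pi * (y' / z - x)) != 0.
Proof.
move=> z0 e0.
have [c0|c0] := eqVneq (cos (2 * pi * (y / z - x))) 0; last first.
  by exists y; rewrite subrr normr0.
have nz : 0 < `|z| by rewrite normr_gt0.
(* The angle is moved by d, that is, y by d z / (2 pi), which is smaller than e. Where the cosine
   vanishes the sine does not, so the new cosine -sin(angle) sin d is nonzero, as 0 < d <= 1 <
   pi. *)
pose d := Num.min 1 (e / `|z|).
have d0 : 0 < d by rewrite lt_min ltr01 divr_gt0.
have pi2 : 2 <= pi :> R by exact: pi_ge2.
have pi0 : (pi : R) != 0 by rewrite gt_eqF // pi_gt0.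
exists (y + d * z / (2 * pi)); split.
  have tp : 0 < 2 * pi :> R by rewrite mulr_gt0 // pi_gt0.
  rewrite opprD addNKr normrN normrM normfV normrM (gtr0_norm d0) (gtr0_norm tp).
  have : d * `|z| <= e by rewrite -ler_pdivlMr // ge_min lexx orbT.
  move=> dz; rewrite ltr_pdivrMr ?mulr_gt0 ?pi_gt0 //.
  by apply: le_lt_trans dz _; nra.
have -> : 2 * pi * ((y + d * z / (2 * pi)) / z - x) = 2 * pi * (y / z - x) + d.
  by move: (pi : R) pi0 => p p0; field; rewrite z0.
rewrite cosD c0 mul0r sub0r oppr_eq0 mulf_neq0 //.
  apply/eqP => s0; have := cos2Dsin2 (2 * pi * (y / z - x)).
  by rewrite c0 s0 expr0n addr0 => /eqP; rewrite eq_sym oner_eq0.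
rewrite gt_eqF // sin_gt0_pi // d0 /=; apply: le_lt_trans (_ : d <= 1) _.
  by rewrite ge_min lexx.
by lra.
Qed.

Section Independence.
Context {R : realType} {k : nat}.
Variables (r0 : int) (r m : 'I_k -> int).
Notation N := 'rV[R]_(1 + k + k).
Notation M := (@nilmanifold R k r0 r m).

Lemma star_sum (F : 'I_(1 + k + k) -> R) :
  \sum_j F j = F ix0 + \sum_i F (ix i) + \sum_i F (iz i).
Proof. by rewrite big_split_ord big_split_ord /= big_ord1. Qed.

Lemma star_integrals_ix0 : star_integrals ix0 = energy :> (M * N -> R).
Proof.
by rewrite /star_integrals (unsplitK (inl _)) (unsplitK (inl _)).
Qed.

Lemma star_integrals_ix i : star_integrals (ix i) = f_Z i :> (M * N -> R).
Proof.
by rewrite /star_integrals (unsplitK (inl _)) (unsplitK (inr _)).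
Qed.

Lemma star_integrals_iz i : star_integrals (iz i) = Ftilde i :> (M * N -> R).
Proof. by rewrite /star_integrals (unsplitK (inr _)). Qed.

(** Up to factors 2 pi, the product of the derivatives of E along Y_0 and of each F_i along Y_i. *)
Definition nondegeneracy (v : M * N) : R :=
  v.2 0 ix0 * \prod_i star_wave 1 i 1 0 (pi / 2) (repr v.1, v.2).

Lemma f_Z_tproj i : @f_Z R k r0 r m i \o tproj (nilproj r0 r m) = Z_momentum i.
Proof.
by apply/funext => w; rewrite /Z_momentum /= /f_Z bZ_delta inner_delta.
Qed.

Lemma Ftilde_tproj i :
  @Ftilde R k r0 r m i \o tproj (nilproj r0 r m) = star_wave 1 i 0 0 0.
Proof. by apply/funext => -[p Y]; rewrite /= Ftilde_nilproj Ftilde_liftE. Qed.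

Lemma derive_energy_P (w : N * N) a :
  'D_(0, delta_mx 0 a) (energy \o tproj (nilproj r0 r m)) w = w.2 0 a.
Proof.
apply: (@derive_quadratic _ _ _ _ _ _ 2^-1) => t.
rewrite /energy /=; move: w.2 => Y.
rewrite innerDl innerZl (innerC Y) innerDl innerZl !inner_delta !mxE !eqxx /=.
by move: (inner Y Y) (Y 0 a) => u v; field.
Qed.

(** Only the fibre half of the gradients is used. In a vanishing combination, the Y_0 column kills
    the coefficient of E, the Y_i column then that of F_i, and the Y_{z_i} column finally that of
    f_{Z_i}. *)
Lemma independent_star_integrals w :
  nondegeneracy (tproj (nilproj r0 r m) w) != 0 ->
  independent_at star_frame (nilproj r0 r m) (@star_integrals R k r0 r m) w.
Proof.
case: w => p Y; rewrite /nondegeneracy /= mulf_eq0 negb_or.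
move=> /andP[Y0 /prodf_neq0 W].
have {}W i : star_wave 1 i 1 0 (pi / 2) (p, Y) != 0.
  by rewrite -(star_wave_repr r0 r m); exact: W.
rewrite /independent_at -kermx_eq0; apply/rowV0P => u /sub_kermxP.
set A := \matrix_j _ => uA.
(* The slots are crossed: [u 0 (ix i)] multiplies f_{Z_i}, and [u 0 (iz i)] multiplies F_i. *)
have eqn a : u 0 ix0 * Y 0 a + \sum_i u 0 (ix i) * (a == iz i)%:R +
   \sum_i u 0 (iz i) * (2 * pi * star_wave 1 i 1 0 (pi / 2) (p, Y) * (a == ix i)%:R +
     (2 * star_wave 1 i 3 0 0 (p, Y) - 2 * pi * star_wave 1 i 2 1 (pi / 2) (p, Y))
     * (a == iz i)%:R) = 0.
  have : (u *m A) 0 (rshift _ a) = 0 by rewrite uA mxE.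
  rewrite mxE star_sum => E.
  have AE j : A j (rshift _ a) =
      'D_(0, delta_mx 0 a) (star_integrals j \o tproj (nilproj r0 r m)) (p, Y).
    by rewrite /A mxE /gradient row_mxEr mxE.
  rewrite -[RHS]E AE star_integrals_ix0 derive_energy_P; congr (_ + _ + _).
    apply: eq_bigr => i _.
    by rewrite AE star_integrals_ix f_Z_tproj derive_Z_momentum_P.
  apply: eq_bigr => i _.
  by rewrite AE star_integrals_iz Ftilde_tproj derive_star_wave_P.
have u0 : u 0 ix0 = 0.
  have := eqn ix0; rewrite !big1 => [|i _|i _]; last 2 first.
  - by rewrite !star_index_eqE !mulr0 addr0 mulr0.
  - by rewrite star_index_eqE mulr0.
  by rewrite !addr0 => /eqP; rewrite mulf_eq0 (negPf Y0) orbF => /eqP.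
have uz i : u 0 (iz i) = 0.
  have := eqn (ix i); rewrite u0 mul0r add0r big1 => [|j _]; last first.
    by rewrite star_index_eqE mulr0.
  rewrite (bigD1 i) //= big1 => [|j ji]; last first.
    by rewrite !star_index_eqE eq_sym (negPf ji) !mulr0 addr0 mulr0.
  rewrite eqxx star_index_eqE mulr0 mulr1 !addr0 add0r => /eqP.
  rewrite mulf_eq0 => /orP[/eqP//|].
  by rewrite mulf_eq0 (negPf (W i)) orbF gt_eqF // mulr_gt0 // pi_gt0.
apply/rowP => a; rewrite mxE; case: (star_indexP a) => [//|i|//].
have := eqn (iz i); rewrite u0 mul0r add0r (bigD1 i) //= big1 => [|j ji]; last first.
  by rewrite star_index_eqE eq_sym (negPf ji) mulr0.
rewrite big1 => [|j _]; last by rewrite uz mul0r.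
by rewrite eqxx mulr1 !addr0.
Qed.

Lemma nondegeneracy_continuous : continuous nondegeneracy.
Proof.
have cvY a : continuous (fun v : M * N => v.2 0 a).
  move=> v; apply: (@continuous_comp _ _ _ snd (fun Y : N => Y 0 a)).
    exact: cvg_snd.
  exact: coord_continuous.
(* With weight 0 the first component is mere filler, and [v.2] avoids any choice of a
   representative. *)
have cwave i c : continuous (fun v : M * N => star_wave 0 i 1 0 c (v.2, v.2)).
  move=> v.
  apply: (@continuous_comp _ _ _ (fun v : M * N => (v.2, v.2))
    (star_wave 0 i 1 0 c)).
    have csnd : snd @ v --> v.2 by exact: cvg_snd.
    exact: (cvg_pair csnd csnd).
  exact: (smooth_star_wave 0 i 1 0 c 0).
(* A function of x_0 of period 1 is constant on cosets, so it factors continuously through the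
   quotient. *)
have cpos (g : R -> R) : continuous g ->
    (forall (n : int) t, g (t + 2 * pi * n%:~R) = g t) ->
    continuous (fun v : M * N => g (2 * pi * repr v.1 0 ix0)).
  move=> cg gper v.
  apply: (@continuous_comp _ _ _ fst (fun q : M => g (2 * pi * (repr q : N) 0 ix0))).
    exact: cvg_fst.
  apply: (@repr_comp_continuous _ _ _ (fun p : N => g (2 * pi * p 0 ix0))).
    move=> p; apply: (@continuous_comp _ _ _ (fun p : N => 2 * pi * p 0 ix0) g).
      have cc : (fun p : N => p 0 ix0) @ p --> p 0 ix0 by exact: coord_continuous.
      have c2 : (fun=> 2 * pi : R) @ nbhs p --> (2 * pi : R) by exact: cvg_cst.
      exact: (cvgM c2 cc).
    exact: cg.
  move=> p q /eqP/nilprojE[l [[n ln] _ _] ->]; apply/eqP.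
  rewrite -!cx0E mkN_x0 ln; move: (r0 * _ * n) (cx0 p) => z t.
  by rewrite (_ : 2 * pi * (z%:~R + t) = 2 * pi * t + 2 * pi * z%:~R) ?gper //; ring.
have -> : nondegeneracy = fun v => v.2 0 ix0 * \prod_i
    (star_wave 0 i 1 0 (pi / 2) (v.2, v.2) * cos (2 * pi * (repr v.1 : N) 0 ix0) +
     star_wave 0 i 1 0 0 (v.2, v.2) * sin (2 * pi * (repr v.1 : N) 0 ix0)).
  apply/funext => v; congr (_ * _); apply: eq_bigr => i _.
  rewrite /star_wave /wave /= !mul0r !subr0 addr0 !sinDpihalf mul1r mulrBr cosB.
  by move: (sin _) (cos _) (sin _) (cos _) => *; ring.
move=> v; apply: cvgM; first exact: cvY.
elim: (index_enum _) => [|i s IHs].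
  have c1 : (fun=> 1 : R) @ nbhs v --> (1 : R) by exact: cvg_cst.
  by rewrite big_nil; under eq_fun do rewrite big_nil.
under eq_fun do rewrite big_cons.
rewrite big_cons; apply: cvgM => //; apply: cvgD; apply: cvgM.
- exact: cwave.
- apply: cpos; [exact: continuous_cos | move=> n t].
  by rewrite -!sinDpihalf addrAC sinD2pi_int.
- exact: cwave.
- by apply: cpos; [exact: continuous_sin | exact: sinD2pi_int].
Qed.

Lemma nondegeneracy_open : open [set v | nondegeneracy v != 0].
Proof.
apply: (@open_comp _ _ nondegeneracy [set x | x != 0]); last exact: open_neq.
by move=> v _; exact: nondegeneracy_continuous.
Qed.

Lemma nondegeneracy_dense : dense [set v | nondegeneracy v != 0].
Proof.
move=> O [[c Y] OcY] oO.
have [[A B] /= [Ac BY] AB] : nbhs (c, Y) O by exact: open_nbhs_nbhs.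
have /nbhs_ballP[e e0 eB] := BY.
(* The base point stays fixed and only Y moves. The z_i are chosen before the y_i because the
   condition on the cosine involves y_i / z_i. *)
have [y0 [Yy0 y0n]] := exists_near_neq0 (Y 0 ix0) e e0.
have /choice[z Hz] i := exists_near_neq0 (Y 0 (iz i)) e e0.
have /choice[y Hy] i := exists_near_cos_neq0 ((repr c : N) 0 ix0) (Y 0 (ix i))
   (z i) e (Hz i).2 e0.
exists (c, mkN y0 (\row_i y i) (\row_i z i)); split.
  apply: AB; split; first exact: nbhs_singleton.
  apply: eB; split=> // i a; rewrite (ord1 i).
  case: (star_indexP a) => [|j|j]; rewrite ?(mkN_ix0, mkN_ix, mkN_iz) ?mxE //.
    exact: (Hy j).1.
  exact: (Hz j).1.
rewrite /nondegeneracy /= mkN_ix0 mulf_neq0 //; apply/prodf_neq0 => i _.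
rewrite /star_wave /wave /= mkN_ix mkN_iz !mxE expr0 mulr1 mul1r sinDpihalf.
rewrite mulf_neq0 ?(Hy i).2 // /flat_exp (negPf (Hz i).2).
by rewrite mulf_neq0 ?expf_neq0 ?invr_eq0 ?(Hz i).2 // gt_eqF // expR_gt0.
Qed.

End Independence.

(** * The integrals form a Liouville system *)

Section Liouville.
Context {R : realType} {k : nat}.
Variables (r0 : int) (r m : 'I_k -> int).
Notation N := 'rV[R]_(1 + k + k).
Notation proj := (@nilproj R k r0 r m).

Lemma energy_sharp :
  (energy \o tproj proj) \o sharp star_frame = @hamiltonian R k.
Proof. by apply/funext => w; rewrite /= sharp_star. Qed.

Lemma f_Z_sharp i :
  (f_Z i \o tproj proj) \o sharp star_frame = @Z_momentum R k i.
Proof.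
rewrite f_Z_tproj; apply/funext => w.
by rewrite /= sharp_star /Z_momentum mkN_iz czE.
Qed.

(** Since Y_i = P_i + x_0 P_{z_i} / 2, the phase Y_i / P_{z_i} - x_0 becomes P_i / P_{z_i} - x_0 /
    2; where P_{z_i} = 0 both sides vanish. *)
Lemma Ftilde_sharp i :
  (Ftilde i \o tproj proj) \o sharp star_frame = star_wave 2^-1 i 0 0 0.
Proof.
rewrite Ftilde_tproj; apply/funext => w.
rewrite /= sharp_star /star_wave /wave /= mkN_ix mkN_iz czE cx0E.
have [->|z0] := eqVneq (w.2 0 (iz i)) 0; first by rewrite flat_exp0 !mul0r.
rewrite !expr0; congr (_ * sin _).
have -> : (cx w.2 + (2^-1 * w.1 0 ix0) *: cz w.2) 0 i =
    w.2 0 (ix i) + 2^-1 * w.1 0 ix0 * w.2 0 (iz i).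
  by rewrite -cxE -czE [LHS]mxE [X in _ + X = _]mxE.
move: (w.2 0 (iz i)) (w.2 0 (ix i)) (w.1 0 ix0) z0 (pi : R) => z y x z0 p.
by field.
Qed.

Lemma star_integrals_commute (i j : 'I_(1 + k + k)) :
  poisson_commute star_frame proj (star_integrals i) (star_integrals j).
Proof.
move=> w; rewrite /poisson.
case: (star_indexP i) => [|a|a]; case: (star_indexP j) => [|b|b];
  rewrite ?(star_integrals_ix0, star_integrals_ix, star_integrals_iz);
  rewrite ?(energy_sharp, f_Z_sharp, Ftilde_sharp).
- exact: canonical_bracket_self.
- exact: bracket_hamiltonian_Z.
- by rewrite canonical_bracketN bracket_wave_hamiltonian oppr0.
- by rewrite canonical_bracketN bracket_hamiltonian_Z oppr0.
- exact: bracket_Z_Z.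
- by rewrite canonical_bracketN bracket_wave_Z oppr0.
- exact: bracket_wave_hamiltonian.
- exact: bracket_wave_Z.
- exact: bracket_wave_wave.
Qed.

Lemma smooth_star_integrals (j : 'I_(1 + k + k)) : smoothT proj (star_integrals j).
Proof.
case: (star_indexP j) => [|i|i].
- by rewrite star_integrals_ix0; exact: smooth_energy.
- rewrite star_integrals_ix /smoothT f_Z_tproj.
  exact: smooth_linear (is_diff_coord_snd (iz i)).
- by rewrite star_integrals_iz /smoothT Ftilde_tproj; exact: smooth_star_wave.
Qed.

Lemma star_integrals_liouville :
  liouville_system star_frame proj (@star_integrals R k r0 r m).
Proof.
split.
- move=> j; split; first exact: smooth_star_integrals.
  (* The energy is itself the integral of index [ix0], so being a first integral is a case of
     pairwise commutation. *)
  rewrite -(star_integrals_ix0 r0 r m); exact: star_integrals_commute.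
- exact: star_integrals_commute.
- exists [set v | nondegeneracy r0 r m v != 0]; split.
  + exact: nondegeneracy_open.
  + exact: nondegeneracy_dense.
  + by move=> w Uw; exact: independent_star_integrals.
Qed.

End Liouville.

Theorem theorem4p3 (R : realType) (k : nat) (hk : (1 <= k)%N)
    (r0 : int) (r m : 'I_k -> int)
    (hr0 : r0 != 0) (hr : forall i, r i != 0) (hm : forall i, m i != 0) :
  [/\ completely_integrable (@star_frame R k) (nilproj r0 r m),
      forall i p Y, @Ftilde R k r0 r m i (nilproj r0 r m p, Y) =
                    Ftilde_lift i (p, Y) &
      liouville_system (@star_frame R k) (nilproj r0 r m)
        (@star_integrals R k r0 r m)].
Proof.
split; last exact: star_integrals_liouville.
- by exists (@star_integrals R k r0 r m); exact: star_integrals_liouville.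
- exact: Ftilde_nilproj.
Qed.
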